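(* Let $\{X, X_{k,i};\ i \geq 1, k \geq 1\}$ be a double array of i.i.d. real-valued random variables such that $\mathbb{E}X = 0$ and $\mathbb{E}X^2 = 1$. For $n\ge1$ and $i \in\{1,2\}$ let $\overline{X}_i^{(n)} = \frac1n\sum_{k=1}^n X_{k,i}$. Then, for any given $\epsilon > 0$, $$\lim_{n \to \infty} n\,\mathbb{P}\left( n \left( \frac{n}{\log n} \right)^{1/2} \frac{\left| \overline{X}_1^{(n)} \overline{X}_2^{(n)} \right|}{\sqrt{\sum_{k=1}^{n} X_{k,1}^2}\,\sqrt{\sum_{k=1}^{n} X_{k,2}^2}} > \epsilon \right) = 0.$$
   Context: $\log$ is the natural logarithm. A ratio whose denominator vanishes is taken to be $0$. *)

(* Defs.v *)
From mathcomp Require Import all_boot all_order all_algebra.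
From mathcomp Require Import all_classical all_reals all_analysis.

Set Implicit Arguments.
Unset Strict Implicit.
Unset Printing Implicit Defensive.

Import Order.TTheory GRing.Theory Num.Theory.
Import numFieldNormedType.Exports.

Local Open Scope classical_set_scope.
Local Open Scope ring_scope.

(* Mutual independence of the subfamily (Y i), i \in D: the product rule holds
   for every finite set of indices of D, listed without repetition. *)
Definition mutually_independent (d : measure_display) (T : measurableType d)
    (R : realType) (P : probability T R) (I : choiceType) (D : set I)
    (Y : I -> {RV P >-> R}) : Prop :=
  forall (s : seq I) (B : I -> set R),
    uniq s -> (forall i, i \in s -> D i) ->
    (forall i, i \in s -> measurable (B i)) ->
    P (\bigcap_(i in [set` s]) (Y i @^-1` B i)) =
      (\prod_(i <- s) P (Y i @^-1` B i))%E.

Definition identically_distributed (d : measure_display) (T : measurableType d)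
    (R : realType) (P : probability T R) (X Y : {RV P >-> R}) : Prop :=
  forall B : set R, measurable B -> distribution P X B = distribution P Y B.

(* Indices start at 1, so X 0 i and X k 0 are unconstrained.  X0 is a generic
   copy: it has the common law of the X k i (k, i >= 1), and no relation to
   them beyond this is assumed. *)
Definition iid_double_array (d : measure_display) (T : measurableType d)
    (R : realType) (P : probability T R) (X0 : {RV P >-> R})
    (X : nat -> nat -> {RV P >-> R}) : Prop :=
  mutually_independent [set ki : nat * nat | (0 < ki.1)%N /\ (0 < ki.2)%N]
    (fun ki => X ki.1 ki.2) /\
  (forall k i : nat, (0 < k)%N -> (0 < i)%N ->
    identically_distributed (X k i) X0).

Definition sample_mean (d : measure_display) (T : measurableType d)
    (R : realType) (P : probability T R) (X : nat -> nat -> {RV P >-> R})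
    (n i : nat) (w : T) : R :=
  n%:R^-1 * \sum_(1 <= k < n.+1) X k i w.

(* Main.v *)
(* Write S_i and V_i^2 for the sum and the sum of squares of the first n entries
   of column i.  The event says |S_1/V_1| |S_2/V_2| > eps (n log n)^(1/2), so
   one of the |S_i/V_i| exceeds y = eps^(1/2) (n log n)^(1/4), and it suffices
   that self-normalized sums have exponential tails with only two moments.
   Put u = X/sqrt n and clip u = u if |u| <= 1, clip u = 1 otherwise.  Since
   exp (clip u) <= 1 + u + 4 u^2, Chernoff's bound gives
   P (sum of clip (+-u) >= k y) <= exp (4 - k y), and applied to -X^2 it gives
   V^2 > k^2 n off an event of probability exp (-k^2 n), for some k > 0.
   Outside these events |S| <= y V, because each of the terms with
   |u| > 1 is at most V and clip counts them.  Finally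
   n exp (-k y) = O(n / y^4) = O(1 / log n). *)
Require Import Defs.
From mathcomp Require Import all_boot all_order all_algebra.
From mathcomp Require Import all_classical all_reals all_analysis.
From mathcomp Require Import measurable_realfun.
From mathcomp Require Import ring lra.

Set Implicit Arguments.
Unset Strict Implicit.
Unset Printing Implicit Defensive.

Import Order.TTheory GRing.Theory Num.Theory.
Import numFieldNormedType.Exports.
Import HBNNSimple.
Local Open Scope classical_set_scope.
Local Open Scope ring_scope.

(** * Independence: products of expectations and Chernoff's bound *)

Section independence.
Context {R : realType} {d : measure_display} {T : measurableType d}.
Variable P : probability T R.

(* The set functions [B |-> E (W; Y \in B)] and [B |-> c * P (Y \in B)] are
   measures on the line, so their agreement passes to integrals. *)
Lemma integral_weighted_comp (W : T -> R) (Y : {RV P >-> R}) (c : \bar R)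
    (f : R -> R) :
  measurable_fun setT W -> (forall w, 0 <= W w) -> (0 <= c)%E ->
  c \is a fin_num ->
  measurable_fun setT f -> (forall x, 0 <= f x) ->
  (forall B, measurable B ->
    \int[P]_w (W w * \1_B (Y w))%:E = c * \int[P]_w (\1_B (Y w))%:E)%E ->
  (\int[P]_w (W w * f (Y w))%:E = c * \int[P]_w (f (Y w))%:E)%E.
Proof.
move=> mW W0 c0 cfin mf f0 H.
have mY : measurable_fun setT Y by exact: measurable_funPT.
have mEf : measurable_fun [set: R] (EFin \o f) by exact/measurable_EFinP.
pose f_ := nnsfun_approx measurableT mEf.
have mfY n : measurable_fun setT (fun w => f_ n (Y w)).
  by apply: measurableT_comp.
have cvgf x : (f_ n x)%:E @[n --> \oo] --> (f x)%:E.
  by apply: (cvg_nnsfun_approx measurableT mEf) => // y _; rewrite lee_fin.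
have ndf x a b : (a <= b)%N -> f_ a x <= f_ b x.
  by move=> ab; exact/lefP/nd_nnsfun_approx.
(* For a simple function, expand over its finitely many values and use the hypothesis on each level
   set. *)
have Hs n : (\int[P]_w (W w * f_ n (Y w))%:E = c * \int[P]_w (f_ n (Y w))%:E)%E.
  have m1 r : measurable_fun setT (fun w => \1_(f_ n @^-1` [set r]) (Y w) : R).
    by apply: measurableT_comp.
  (* A negative [r] is not a value of [f_ n], so its indicator vanishes. *)
  have r0 r w : 0 <= r * \1_(f_ n @^-1` [set r]) (Y w).
    rewrite indicE; case: (boolP (_ \in _)); rewrite ?mulr0// inE => <-.
    by rewrite mulr1.
  have mr1 r : measurable_fun setT
      (fun w => (r * \1_(f_ n @^-1` [set r]) (Y w))%:E).
    by apply/measurable_EFinP; exact: measurable_funM.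
  have mrW r : measurable_fun setT
      (fun w => (W w * (r * \1_(f_ n @^-1` [set r]) (Y w)))%:E).
    by apply/measurable_EFinP; apply: measurable_funM => //;
      exact: measurable_funM.
  under eq_integral do rewrite fimfunE.
  under [in RHS]eq_integral do rewrite fimfunE.
  under eq_integral => w _.
    rewrite EFinM -fsumEFin// ge0_mule_fsumr; last by move=> r; rewrite lee_fin.
    under eq_fsbigr do rewrite -EFinM.
    over.
  under [in RHS]eq_integral => w _ do rewrite -fsumEFin//.
  rewrite ge0_integral_fsum//; last first.
    by move=> r w _; rewrite lee_fin mulr_ge0.
  rewrite ge0_integral_fsum//; last by move=> r w _; rewrite lee_fin.
  rewrite ge0_mule_fsumr; last first.
    by move=> r; apply: integral_ge0 => w _; rewrite lee_fin.
  apply: eq_fsbigr => r; rewrite inE => -[x _ <-].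
  under eq_integral do rewrite mulrCA EFinM.
  under [in RHS]eq_integral do rewrite EFinM.
  rewrite ge0_integralZl//; last 2 first.
  - exact/measurable_EFinP.
  - by rewrite lee_fin.
  rewrite ge0_integralZl//; last 3 first.
  - by apply/measurable_EFinP; exact: measurable_funM.
  - by move=> w _; rewrite lee_fin mulr_ge0.
  - by rewrite lee_fin.
  by rewrite muleCA H.
(* Both sides pass to the limit by monotone convergence, and limits are unique. *)
have cvgW : (\int[P]_w (W w * f_ n (Y w))%:E @[n --> \oo] -->
    \int[P]_w (W w * f (Y w))%:E)%E.
  have -> : (\int[P]_w (W w * f (Y w))%:E =
      \int[P]_w (limn (fun n => (W w * f_ n (Y w))%:E)))%E.
    apply: eq_integral => w _; apply/esym/cvg_lim => //.
    under eq_fun do rewrite EFinM.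
    by rewrite EFinM; apply: cvgeZl.
  apply: cvg_monotone_convergence => //.
  - by move=> n; apply/measurable_EFinP; exact: measurable_funM.
  - by move=> n w _; rewrite lee_fin mulr_ge0.
  - by move=> w _ a b ab; rewrite lee_fin ler_wpM2l// ndf.
have cvgY : (\int[P]_w (f_ n (Y w))%:E @[n --> \oo] -->
    \int[P]_w (f (Y w))%:E)%E.
  have -> : (\int[P]_w (f (Y w))%:E =
      \int[P]_w (limn (fun n => (f_ n (Y w))%:E)))%E.
    by apply: eq_integral => w _; apply/esym/cvg_lim.
  apply: cvg_monotone_convergence => //.
  - by move=> n; apply/measurable_EFinP.
  - by move=> n w _; rewrite lee_fin.
  - by move=> w _ a b ab; rewrite lee_fin ndf.
apply: (cvg_unique _ cvgW) => //.
by rewrite (funext Hs); exact: cvgeZl.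
Qed.
Lemma integral_indic_RV (Y : {RV P >-> R}) (B : set R) : measurable B ->
  (\int[P]_w (\1_B (Y w))%:E = P (Y @^-1` B))%E.
Proof.
move=> mB; rewrite -(setIT (Y @^-1` B)) -integral_indic//.
exact: measurable_funPTI.
Qed.

Lemma prod_indic_preimage (I : eqType) (Y : I -> T -> R) (B : I -> set R)
    (s : seq I) (w : T) :
  \prod_(i <- s) \1_(B i) (Y i w) =
  \1_(\bigcap_(i in [set` s]) (Y i @^-1` B i)) w :> R.
Proof.
rewrite [RHS]indicE; case: (boolP (w \in _)); rewrite ?inE ?notin_setE => h.
  apply: big1_seq => i /= is_; rewrite indicE mem_set//; exact: h.
apply/eqP; rewrite prodf_seq_eq0; apply: contrapT => h'.
apply: h => i /= is_; apply: contrapT => nB; apply: h'.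
apply/hasP; exists i => //=.
by rewrite indicE memNset.
Qed.

(* The induction turns the indicator factors into the functions [f i] one at a
   time. *)
Lemma expectation_prod_indep_indic (I : choiceType) (D : set I)
    (Y : I -> {RV P >-> R}) (s s' : seq I) (f : I -> R -> R) (B : I -> set R) :
  mutually_independent D Y ->
  uniq (s ++ s') -> (forall i, i \in s ++ s' -> D i) ->
  (forall i, measurable_fun setT (f i)) -> (forall i x, 0 <= f i x) ->
  (forall i, i \in s ++ s' -> \int[P]_w (f i (Y i w))%:E \is a fin_num)%E ->
  (forall i, i \in s' -> measurable (B i) /\ f i = \1_(B i)) ->
  (\int[P]_w (\prod_(i <- s ++ s') f i (Y i w))%:E =
   \prod_(i <- s ++ s') \int[P]_w (f i (Y i w))%:E)%E.
Proof.
move=> indep; elim: s s' f B => [|i s IH] s' f B /=.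
  move=> us' sD _ _ _ fB.
  under eq_integral => w _.
    rewrite (eq_big_seq (fun i => \1_(B i) (Y i w))); last first.
      by move=> i is' /=; rewrite (fB i is').2.
    rewrite (@prod_indic_preimage _ (fun i => Y i : T -> R)).
    over.
  have mYB i : i \in s' -> measurable (Y i @^-1` B i).
    by move=> is'; apply: measurable_funPTI => //; exact: (fB i is').1.
  rewrite integral_indic//; last first.
    by apply: fin_bigcap_measurable => //; exact: finite_seq.
  rewrite setIT.
  apply: etrans (indep s' B us' sD (fun i is' => (fB i is').1)) _.
  apply: eq_big_seq => i is' /=.
  by rewrite (fB i is').2 integral_indic_RV//; exact: (fB i is').1.
move=> /andP[inss' uss'] sD mf f0 ffin fB.
have mfY j : measurable_fun setT (fun w => f j (Y j w)).
  by apply: measurableT_comp => //; exact: measurable_funPT.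
(* The product of all factors other than that of [i] serves as the weight, so it is enough to treat
   indicators in place of [f i]. *)
under eq_integral do rewrite big_cons mulrC.
rewrite big_cons muleC.
apply: integral_weighted_comp => //.
- exact: measurable_prod.
- by move=> w; apply: prodr_ge0.
- by apply: prode_ge0 => j _; apply: integral_ge0 => w _; rewrite lee_fin.
- rewrite big_seq; apply: prode_fin_num => j js.
  by apply: ffin; rewrite inE js orbT.
move=> B0 mB0.
(* Once [f i] is replaced by an indicator, [i] may join [s'], and the induction hypothesis applies
   to the shorter [s]. *)
pose f' j := if j == i then \1_B0 else f j.
pose B' j := if j == i then B0 else B j.
have pss : perm_eq (s ++ i :: s') (i :: s ++ s') 
  by rewrite (perm_catCA s [:: i] s').
have f'E j : j \in s ++ s' -> f' j = f j.
  by rewrite /f'; case: eqP => // -> /(negP inss').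
have f'i : f' i = \1_B0 by rewrite /f' eqxx.
have : (\int[P]_w (\prod_(j <- s ++ i :: s') f' j (Y j w))%:E =
    \prod_(j <- s ++ i :: s') \int[P]_w (f' j (Y j w))%:E)%E.
  apply: (IH (i :: s') f' B').
  - by rewrite (perm_uniq pss) /= inss'.
  - by move=> j; rewrite (perm_mem pss); exact: sD.
  - by move=> j; rewrite /f'; case: ifP.
  - by move=> j x; rewrite /f'; case: ifP.
  - move=> j; rewrite (perm_mem pss) /f'; case: ifP => // _; last exact: ffin.
    by rewrite integral_indic_RV// fin_num_measure//; exact: measurable_funPTI.
  - move=> j; rewrite inE /f' /B'; case: ifP => //= _ js'; exact: fB.
rewrite (perm_big _ pss) big_cons f'i muleC.
rewrite (eq_big_seq (fun j => \int[P]_w (f j (Y j w))%:E)%E); last first.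
  by move=> j js /=; rewrite f'E.
move=> <-; apply: eq_integral => w _.
rewrite (perm_big _ pss) big_cons f'i mulrC.
by congr (_ * _)%:E; apply: eq_big_seq => j js; rewrite f'E.
Qed.

Lemma expectation_prod_indep (I : choiceType) (D : set I)
    (Y : I -> {RV P >-> R}) (s : seq I) (f : I -> R -> R) :
  mutually_independent D Y ->
  uniq s -> (forall i, i \in s -> D i) ->
  (forall i, measurable_fun setT (f i)) -> (forall i x, 0 <= f i x) ->
  (forall i, i \in s -> \int[P]_w (f i (Y i w))%:E \is a fin_num)%E ->
  (\int[P]_w (\prod_(i <- s) f i (Y i w))%:E =
   \prod_(i <- s) \int[P]_w (f i (Y i w))%:E)%E.
Proof.
move=> indep us sD mf f0 ffin.
have := @expectation_prod_indep_indic I D Y s [::] f (fun=> set0) indep.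
by rewrite cats0; apply.
Qed.

Lemma expectation_identically_distributed (X Y : {RV P >-> R}) (f : R -> R) :
  identically_distributed X Y -> measurable_fun setT f ->
  (forall x, 0 <= f x) ->
  (\int[P]_w (f (X w))%:E = \int[P]_w (f (Y w))%:E)%E.
Proof.
move=> XY mf f0.
have mEf : measurable_fun [set: R] (EFin \o f) by exact/measurable_EFinP.
have Ef0 x : (0 <= (EFin \o f) x)%E by rewrite lee_fin.
rewrite -(ge0_integral_distribution X mEf Ef0).
rewrite -(ge0_integral_distribution Y mEf Ef0).
by apply: eq_measure_integral => A mA _; exact: XY.
Qed.

(** Markov's inequality for the exponential of the sum; independence turns the mean of the product
    into a product of means, all equal to that for [X0]. The level [a] may be negative, which allows
    lower bounds on sums of squares by taking [g x = - x ^+ 2]. *)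
Lemma chernoff_iid (I : choiceType) (D : set I) (Y : I -> {RV P >-> R})
    (X0 : {RV P >-> R}) (s : seq I) (g : R -> R) (M a : R) :
  mutually_independent D Y ->
  (forall i, D i -> identically_distributed (Y i) X0) ->
  uniq s -> (forall i, i \in s -> D i) -> measurable_fun setT g ->
  (\int[P]_w (expR (g (X0 w)))%:E <= M%:E)%E ->
  (P [set w | a <= \sum_(i <- s) g (Y i w)]%R <=
    (expR (- a) * M ^+ size s)%:E)%E.
Proof.
move=> indep idY us sD mg gM.
have mE : measurable_fun setT (fun x => expR (g x)) by exact: measurableT_comp.
have EY i : i \in s ->
    (\int[P]_w (expR (g (Y i w)))%:E = \int[P]_w (expR (g (X0 w)))%:E)%E.
  move=> is_.
  apply: (@expectation_identically_distributed _ _ (expR \o g)) => //.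
    exact/idY/sD.
  by move=> x; exact: expR_ge0.
have X0_ge0 : (0 <= \int[P]_w (expR (g (X0 w)))%:E)%E.
  by apply: integral_ge0 => w _; rewrite lee_fin expR_ge0.
have X0_fin : (\int[P]_w (expR (g (X0 w)))%:E \is a fin_num)%E.
  by rewrite ge0_fin_numE// (le_lt_trans gM)// ltry.
have mS : measurable_fun setT (fun w => \sum_(i <- s) g (Y i w)).
  apply: measurable_sum => i.
  exact: (measurableT_comp mg (measurable_funPT (Y i))).
have mA : measurable [set w | a <= \sum_(i <- s) g (Y i w)].
  rewrite -[X in measurable X]setTI.
  exact: (measurable_fun_ler (measurable_cst a) mS).
rewrite -(setIT [set w | _]) -integral_indic//.
apply: (@le_trans _ _
    (\int[P]_w ((expR (- a))%:E * (expR (\sum_(i <- s) g (Y i w)))%:E))%E).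
  apply: ge0_le_integral => //.
  - by apply/measurable_EFinP.
  - apply/measurable_EFinP; apply: measurable_funM => //.
    exact: measurableT_comp.
  - move=> w _; rewrite -EFinM -expRD lee_fin indicE.
    case: (boolP (_ \in _)) => [|_]; last exact: expR_ge0.
    rewrite inE /= => h.
    by rewrite -expR0 ler_expR addrC subr_ge0.
rewrite ge0_integralZl//; last first.
  by apply/measurable_EFinP; exact: measurableT_comp.
rewrite EFinM lee_wpmul2l ?lee_fin ?expR_ge0//.
under eq_integral do rewrite expR_sum.
rewrite (@expectation_prod_indep I D Y s (fun=> expR \o g))//; last 2 first.
- by move=> i x; exact: expR_ge0.
- by move=> i is_; rewrite EY.
rewrite (eq_big_seq _ EY) -(fineK X0_fin) prodEFin lee_fin.
rewrite big_const_seq count_predT iter_mulr_1 lerXn2r ?nnegrE//.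
- exact: fine_ge0.
- by rewrite -lee_fin (le_trans X0_ge0).
- by rewrite -lee_fin fineK.
Qed.

End independence.

(** * A truncation with a quadratic exponential bound *)

(** Values below [-1] are also sent to [1]: a large term is counted once whatever its sign, both for
    [u] and for [- u]. *)
Definition clip {R : realType} (u : R) : R := if `|u| <= 1 then u else 1.

Lemma measurable_clip {R : realType} : measurable_fun setT (@clip R).
Proof.
apply: measurable_fun_ifT => //.
by apply: measurable_fun_ler => //; exact: measurableT_comp.
Qed.

(* Below [3/4] the bound follows from [expR u * (1 - u) <= 1], and above from
   [expR 1 <= 4]; the slack in the constant makes it hold for large [`|u|]. *)
Lemma expR_clip_le {R : realType} (u : R) :
  expR (clip u) <= 1 + u + 4 * u ^+ 2.
Proof.
have expRM1B (v : R) : expR v * (1 - v) <= 1.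
  rewrite -[leRHS](expRxMexpNx_1 v) ler_wpM2l ?expR_ge0//; exact: expR_ge1Dx.
have e4 : expR (1 : R) <= 4.
  (* This says [expR 2^-1 <= 2], and squaring gives the claim. *)
  have e12 := expRM1B 2^-1; have e0 := expR_ge0 (2^-1 : R).
  have -> : (1 : R) = 2^-1 + 2^-1 by lra.
  by rewrite expRD; nra.
(* The threshold suits both cases: [(1 + u + 4 u^2) (1 - u) = 1 + u^2 (3 - 4 u)] is at least [1] up
   to [3/4], where [1 + u + 4 u^2] reaches [4]. *)
have [u34|u34] := lerP u (3 / 4); last first.
  apply: (@le_trans _ _ 4); last nra.
  apply: le_trans e4; rewrite ler_expR /clip; case: ifP => // /ler_normlP.
  by case.
rewrite /clip; case: (lerP `|u| 1) => u1.
  rewrite -(@ler_pM2r _ (1 - u)); last lra.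
  apply: le_trans (expRM1B u) _; nra.
apply: le_trans e4 _.
by move: u1; rewrite ltr_normr => /orP[|]; nra.
Qed.

(** * Exponential moments obtained from mean zero and variance one *)

Section moments.
Context {R : realType} {d : measure_display} {T : measurableType d}.
Variables (P : probability T R) (X0 : {RV P >-> R}).
Hypothesis mean0 : ('E_P[X0] = 0)%E.
Hypothesis var1 : ('E_P[(X0 : T -> R) ^+ 2] = 1)%E.

Let mX0 : measurable_fun setT X0. Proof. exact: measurable_funPT. Qed.

Let int_sqr : (\int[P]_w (X0 w ^+ 2)%:E = 1)%E.
Proof. by rewrite -var1 unlock exprfctE. Qed.

Let mX0sqr : measurable_fun setT (fun w => X0 w ^+ 2).
Proof. exact: measurable_funX. Qed.

Let integrable_sqr : P.-integrable setT (fun w => (X0 w ^+ 2)%:E).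
Proof.
apply/integrableP; split; first exact/measurable_EFinP.
under eq_integral do rewrite abse_EFin ger0_norm ?sqr_ge0//.
by rewrite int_sqr ltry.
Qed.

Let integral_const (r : R) : (\int[P]_w r%:E = r%:E)%E.
Proof.
apply: etrans (integral_cst _ measurableT _) _; rewrite -[RHS]mule1.
by congr (_ * _)%E; exact: probability_setT.
Qed.

Let integrable_cst1 : P.-integrable setT (cst 1%:E : T -> \bar R).
Proof. by apply: finite_measure_integrable_cst. Qed.

Let integrable_X0 : P.-integrable setT (EFin \o X0).
Proof.
apply: (@le_integrable _ _ _ _ _ _ _ (fun w => 1%:E + (X0 w ^+ 2)%:E)%E) => //.
- exact/measurable_EFinP.
- move=> w _; rewrite -EFinD !abse_EFin lee_fin [leRHS]ger0_norm.
    by rewrite ler_norml; apply/andP; split; nra.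
  by rewrite addr_ge0// sqr_ge0.
- exact: integrableD.
Qed.

(** Integrating [expR_clip_le] kills the linear term, as the mean is zero, and leaves [1 + 4 t^2].
    For [t^2 = 1/n] the [n]-th power of the bound is the constant [expR 4]. *)
Lemma mgf_clip (t : R) :
  (\int[P]_w (expR (clip (t * X0 w)))%:E <= (expR (4 * t ^+ 2))%:E)%E.
Proof.
apply: (@le_trans _ _ (\int[P]_w (1%:E + (t%:E * (X0 w)%:E +
    (4 * t ^+ 2)%:E * (X0 w ^+ 2)%:E)))%E).
  apply: ge0_le_integral => //.
  - apply/measurable_EFinP; apply: measurableT_comp => //.
    apply: (measurableT_comp measurable_clip); exact: measurable_funM.
  - under eq_fun do rewrite -!EFinM -!EFinD.
    apply/measurable_EFinP; apply: measurable_funD => //.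
    by apply: measurable_funD; exact: measurable_funM.
  - move=> w _; rewrite -!EFinM -!EFinD lee_fin.
    by apply: le_trans (expR_clip_le _) _; lra.
have iM : P.-integrable setT (fun w => t%:E * (X0 w)%:E)%E.
  exact: integrableZl.
have iQ : P.-integrable setT (fun w => (4 * t ^+ 2)%:E * (X0 w ^+ 2)%:E)%E.
  exact: integrableZl.
rewrite integralD//; last exact: integrableD.
rewrite integralD// integralZl// integralZl// int_sqr integral_const.
have -> : (\int[P]_w (X0 w)%:E = 0)%E by rewrite -mean0 unlock.
rewrite mule0 add0e mule1 -EFinD lee_fin.
exact: expR_ge1Dx.
Qed.

(** Let [q] be the mean of [1 - expR (- X0^2)]. If [q] were zero, [X0] would vanish almost surely,
    against the second moment being one. So [q > 0], the mean in question is [1 - q <= expR (- q)],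
    and [k = q / 2] works. *)
Lemma mgf_oppr_sqr : exists k : R, [/\ 0 < k, k <= 1 &
  (\int[P]_w (expR (- X0 w ^+ 2))%:E <= (expR (- (2 * k)))%:E)%E].
Proof.
have e01 w : 0 <= expR (- X0 w ^+ 2) <= 1.
  by rewrite expR_ge0 -expR0 ler_expR oppr_le0 sqr_ge0.
have mE : measurable_fun setT (fun w => expR (- X0 w ^+ 2)).
  by apply: measurableT_comp => //; exact: measurableT_comp.
have mq : measurable_fun setT (fun w => 1 - expR (- X0 w ^+ 2)).
  exact: measurable_funB.
have q0 w : 0 <= 1 - expR (- X0 w ^+ 2) by rewrite subr_ge0; case/andP: (e01 w).
have sum1 : (\int[P]_w (expR (- X0 w ^+ 2))%:E +
    \int[P]_w (1 - expR (- X0 w ^+ 2))%:E = 1)%E.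
  rewrite -ge0_integralD//.
  - under eq_integral do rewrite -EFinD addrC subrK.
    exact: integral_const.
  - exact/measurable_EFinP.
  - by move=> w _; rewrite lee_fin.
  - exact/measurable_EFinP.
have q_ne0 : (\int[P]_w (1 - expR (- X0 w ^+ 2))%:E != 0)%E.
  apply/eqP => int0.
  have : (\int[P]_w `|(1 - expR (- X0 w ^+ 2))%:E| = 0)%E.
    by under eq_integral do rewrite abse_EFin ger0_norm//.
  move/ae_eq_integral_abs => /(_ measurableT).
  have /[swap]/[apply] := (measurable_EFinP _ _).2 mq.
  move=> aeq.
  have : ae_eq P setT (fun w => (X0 w ^+ 2)%:E) (cst 0%E).
    apply: filterS aeq => w /(_ I) /= [] /eqP.
    rewrite subr_eq0 eq_sym -expR0 => /eqP/expR_inj/eqP.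
    by rewrite oppr_eq0 => /eqP ->.
  move=> /ae_eq_integral /= => /(_ measurableT).
  have m2 : measurable_fun setT (fun w => (X0 w ^+ 2)%:E).
    exact/measurable_EFinP.
  move=> /(_ m2 (measurable_cst _)).
  by rewrite int_sqr integral0 => /eqP; rewrite onee_eq0.
have q_ge0 : (0 <= \int[P]_w (1 - expR (- X0 w ^+ 2))%:E)%E.
  by apply: integral_ge0 => w _; rewrite lee_fin.
have e_ge0 : (0 <= \int[P]_w (expR (- X0 w ^+ 2))%:E)%E.
  by apply: integral_ge0 => w _; rewrite lee_fin expR_ge0.
move: sum1 q_ne0 q_ge0 e_ge0.
case: (\int[P]_w (expR (- X0 w ^+ 2))%:E)%E => [r| |] //;
  case: (\int[P]_w (1 - expR (- X0 w ^+ 2))%:E)%E => [q| |] //.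
move=> [rq] q_neq0; rewrite !lee_fin => q_ge0 r_ge0.
have q_gt0 : 0 < q by rewrite lt_def q_ge0 andbT.
exists (q / 2); split; [lra|lra|rewrite lee_fin mulrC divfK//].
by apply: le_trans (expR_ge1Dx _); lra.
Qed.

End moments.

(** * Self-normalized sums: a deterministic bound and its probabilistic form *)

(* The terms with [`|x i| > r] are each at most [Num.sqrt (\sum x i ^+ 2)] in
   absolute value, so their sum is controlled by their number, which is what
   the value [1] of [clip] counts. *)
Lemma self_normalized_sum_le {R : realType} (I : eqType) (s : seq I)
    (x : I -> R) (r k y : R) :
  0 < r -> 0 < k -> k <= 1 -> (k * r) ^+ 2 <= \sum_(i <- s) x i ^+ 2 ->
  \sum_(i <- s) clip (r^-1 * x i) <= k * y ->
  \sum_(i <- s) clip (- r^-1 * x i) <= k * y ->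
  `|\sum_(i <- s) x i| <= y * Num.sqrt (\sum_(i <- s) x i ^+ 2).
Proof.
move=> r0 k0 k1 krV clip1 clip2; set V : R := Num.sqrt _.
have V0 : 0 <= V by exact: sqrtr_ge0.
have krleV : k * r <= V.
  by rewrite -(@ger0_norm _ (k * r)) -?sqrtr_sqr ?ler_wsqrtr// mulr_ge0// ltW.
have xV i : i \in s -> `|x i| <= V.
  move=> is_; rewrite -sqrtr_sqr ler_wsqrtr// (big_rem i)//= lerDl.
  by apply: sumr_ge0 => j _; exact: sqr_ge0.
pose small i := `|r^-1 * x i| <= 1.
(* [A] collects the small rescaled terms and [N] counts the large ones; the two clipped sums are
   [A + N] and [- A + N]. *)
pose A := \sum_(i <- s) (if small i then r^-1 * x i else 0).
pose N : R := \sum_(i <- s) (if small i then 0 else 1).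
have clip1E : \sum_(i <- s) clip (r^-1 * x i) = A + N.
  by rewrite -big_split/=; apply: eq_bigr => i _; rewrite /clip /small;
    case: ifP => _; rewrite ?addr0 ?add0r.
have clip2E : \sum_(i <- s) clip (- r^-1 * x i) = - A + N.
  rewrite -sumrN -big_split/=; apply: eq_bigr => i _.
  by rewrite /clip /small mulNr normrN; case: ifP => _;
    rewrite ?addr0 ?oppr0 ?add0r.
have N0 : 0 <= N by apply: sumr_ge0 => i _; case: ifP.
have SAN : `|\sum_(i <- s) x i| <= r * `|A| + V * N.
  have -> : \sum_(i <- s) x i =
      r * A + \sum_(i <- s) (if small i then 0 else x i).
    rewrite mulr_sumr -big_split/=; apply: eq_bigr => i _; case: ifP => _.
      by rewrite addr0 mulrA divff ?mul1r// gt_eqF.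
    by rewrite mulr0 add0r.
  apply: le_trans (ler_normD _ _) _; rewrite normrM gtr0_norm// lerD2l.
  apply: le_trans (ler_norm_sum _ _ _) _; rewrite mulr_sumr.
  rewrite big_seq [leRHS]big_seq; apply: ler_sum => i is_.
  by case: ifP => _; rewrite ?normr0 ?mulr0// mulr1 xV.
have ANy : `|A| + N <= k * y.
  move: clip1 clip2; rewrite clip1E clip2E => clip1 clip2.
  suff : `|A| <= k * y - N by lra.
  by rewrite ler_norml; apply/andP; split; lra.
(* After multiplication by [k], the small part is absorbed by [k r <= V] and the large part by
   [k <= 1]. *)
rewrite -(ler_pM2l k0); apply: (@le_trans _ _ (V * (`|A| + N))); last first.
  by rewrite [leRHS]mulrA [leRHS]mulrC; exact: ler_wpM2l.
apply: (@le_trans _ _ (k * (r * `|A| + V * N))); first by rewrite ler_pM2l.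
rewrite [leLHS]mulrDr [leRHS]mulrDr lerD//.
  by rewrite mulrA ler_wpM2r.
by rewrite ler_piMl// mulr_ge0.
Qed.

(** Union bound over three Chernoff events: [A1], where the sum of squares is too small, and [A2],
    [A3], where a clipped sum of one sign is too large. Outside them [self_normalized_sum_le]
    applies with [r] the square root of the sample size. *)
Lemma self_normalized_tail {R : realType} {d : measure_display}
    {T : measurableType d} (P : probability T R) (I : choiceType) (D : set I)
    (Y : I -> {RV P >-> R}) (X0 : {RV P >-> R}) (s : seq I) (k y : R) :
  mutually_independent D Y ->
  (forall i, D i -> identically_distributed (Y i) X0) ->
  ('E_P[X0] = 0)%E -> ('E_P[(X0 : T -> R) ^+ 2] = 1)%E ->
  0 < k -> k <= 1 ->
  (\int[P]_w (expR (- X0 w ^+ 2))%:E <= (expR (- (2 * k)))%:E)%E ->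
  uniq s -> (forall i, i \in s -> D i) -> (0 < size s)%N ->
  (P [set w | y * Num.sqrt (\sum_(i <- s) Y i w ^+ 2) <
             `|\sum_(i <- s) Y i w|]%R <=
    (expR (- (k ^+ 2 * (size s)%:R)) + 2 * expR (4 - k * y))%:E)%E.
Proof.
move=> indep idY mean0 var1 k0 k1 hk us sD s0.
set n : R := (size s)%:R; have n0 : 0 < n by rewrite ltr0n.
pose r := Num.sqrt n; have r0 : 0 < r by rewrite sqrtr_gt0.
have rVsq : (r^-1) ^+ 2 = n^-1 by rewrite exprVn sqr_sqrtr// ltW.
pose A1 := [set w |
  - (k ^+ 2 * n) <= \sum_(i <- s) (fun x => - x ^+ 2) (Y i w)].
pose A2 := [set w | k * y <= \sum_(i <- s) clip (r^-1 * Y i w)].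
pose A3 := [set w | k * y <= \sum_(i <- s) clip (- r^-1 * Y i w)].
have mclip t : measurable_fun setT (fun x : R => clip (t * x)).
  by apply: (measurableT_comp measurable_clip); exact: measurable_funM.
have msq : measurable_fun setT (fun x : R => - x ^+ 2).
  by apply: measurableT_comp => //; exact: measurable_funX.
have mge a (g : R -> R) : measurable_fun setT g ->
    measurable [set w | a <= \sum_(i <- s) g (Y i w)].
  move=> mg; rewrite -[X in measurable X]setTI.
  apply: (measurable_fun_ler (measurable_cst a)) => //.
  apply: measurable_sum => i.
  exact: (measurableT_comp mg (measurable_funPT (Y i))).
have mA1 : measurable A1 by exact: mge.
have mA2 : measurable A2 := mge (k * y) _ (mclip r^-1).
have mA3 : measurable A3 := mge (k * y) _ (mclip (- r^-1)).
have mS : measurable_fun setT (fun w => \sum_(i <- s) Y i w).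
  by apply: measurable_sum => i; exact: measurable_funPT.
have mV : measurable_fun setT (fun w => Num.sqrt (\sum_(i <- s) Y i w ^+ 2)).
  apply: (measurableT_comp (continuous_measurable_fun (@sqrt_continuous R))).
  apply: measurable_sum => i; apply: measurable_funX; exact: measurable_funPT.
have PA1 : (P A1 <= (expR (- (k ^+ 2 * n)))%:E)%E.
  apply: le_trans (chernoff_iid _ indep idY us sD msq hk) _.
  rewrite -expRM_natl -expRD lee_fin ler_expR -/n.
  (* The exponent is [k^2 n - 2 k n]; the factor [2] in the hypothesis on [k] pays for the Chernoff
     level. *)
  have kk : k ^+ 2 <= k by nra.
  have := ler_wpM2l (ltW n0) kk; lra.
have PAclip t : t ^+ 2 = n^-1 ->
    (P [set w | k * y <= \sum_(i <- s) clip (t * Y i w)]%R <=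
     (expR (4 - k * y))%:E)%E.
  move=> t2.
  apply: le_trans (chernoff_iid _ indep idY us sD (mclip t)
    (mgf_clip mean0 var1 t)) _.
  rewrite -expRM_natl -expRD lee_fin ler_expR -/n t2.
  by rewrite mulrCA divff ?gt_eqF// mulr1 addrC.
apply: (@le_trans _ _ (P (A1 `|` (A2 `|` A3)))).
  apply: le_measure; rewrite ?inE.
  - rewrite -[X in measurable X]setTI.
    apply: measurable_fun_ltr => //.
      exact: measurable_funM.
    exact: measurableT_comp.
  - by do 2!apply: measurableU => //.
  - move=> w /= Vw; apply: contrapT => /not_orP[nA1 /not_orP[nA2 nA3]].
    move: Vw; apply/negP; rewrite -leNgt.
    apply: (self_normalized_sum_le r0 k0 k1).
    + rewrite exprMn sqr_sqrtr; last exact: ltW.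
      rewrite ltW// -ltrN2 ltNge; apply/negP => h.
      by apply: nA1; rewrite /A1/= sumrN.
    + by rewrite ltW// ltNge; apply/negP.
    + by rewrite ltW// ltNge; apply/negP.
apply: le_trans (measureU2 _ mA1 (measurableU _ _ mA2 mA3)) _.
rewrite EFinD leeD//; apply: le_trans (measureU2 _ mA2 mA3) _.
rewrite mulr_natl mulr2n EFinD leeD//; apply: PAclip => //.
by rewrite sqrrN.
Qed.

(** * Deterministic estimates for the statistic and for the tail bound *)

(** The ratio of sums is at most [y^2], and the choice of [y] makes the scaling exact:
    [n sqrt(n/L) n^-2 sqrt(n L) = 1]. *)
Lemma product_statistic_le {R : realType} (n : nat) (L eps y S1 S2 V1 V2 : R) :
  (0 < n)%N -> 0 < L -> 0 < eps -> y ^+ 2 = eps * Num.sqrt (n%:R * L) ->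
  0 <= y -> 0 <= V1 -> 0 <= V2 -> `|S1| <= y * V1 -> `|S2| <= y * V2 ->
  n%:R * Num.sqrt (n%:R / L) *
    (`|n%:R^-1 * S1 * (n%:R^-1 * S2)| / (V1 * V2)) <= eps.
Proof.
move=> n0 L0 eps0 yE y0 V10 V20 S1y S2y.
have nR0 : 0 < n%:R :> R by rewrite ltr0n.
have ratio : `|S1 * S2| / (V1 * V2) <= y ^+ 2.
  (* With a vanishing denominator the ratio is [0] by the convention on inverses. *)
  have [V0|V0] := eqVneq (V1 * V2) 0.
    by rewrite V0 invr0 mulr0 sqr_ge0.
  rewrite ler_pdivrMr; last by rewrite lt_def V0 mulr_ge0.
  by rewrite normrM expr2 mulrACA ler_pM.
have -> : n%:R^-1 * S1 * (n%:R^-1 * S2) = n%:R^-1 ^+ 2 * (S1 * S2) by ring.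
rewrite normrM [`|n%:R^-1 ^+ 2|]ger0_norm ?sqr_ge0// -mulrA.
set q := (X in _ * X <= _).
have -> : q = n%:R^-1 ^+ 2 * Num.sqrt (n%:R / L) * (`|S1 * S2| / (V1 * V2)).
  by rewrite /q; ring.
apply: le_trans (ler_wpM2l (ltW nR0) (ler_wpM2l _ ratio)) _.
  by rewrite mulr_ge0 ?sqr_ge0 ?sqrtr_ge0.
have sq : Num.sqrt (n%:R / L) * Num.sqrt (n%:R * L) = n%:R.
  rewrite -sqrtrM; last by rewrite divr_ge0// ltW.
  have -> : n%:R / L * (n%:R * L) = n%:R ^+ 2.
    by field; rewrite gt_eqF.
  by rewrite sqrtr_sqr ger0_norm// ltW.
rewrite yE.
have -> : n%:R * (n%:R^-1 ^+ 2 * Num.sqrt (n%:R / L) *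
    (eps * Num.sqrt (n%:R * L))) =
    eps * (n%:R * n%:R^-1 ^+ 2 *
      (Num.sqrt (n%:R / L) * Num.sqrt (n%:R * L))) by ring.
rewrite sq; have -> : n%:R * n%:R^-1 ^+ 2 * n%:R = 1 :> R.
  by field; rewrite gt_eqF.
by rewrite mulr1.
Qed.

(** [expR u] dominates the single term of degree [m.+1] in its series. *)
Lemma expRN_le_pow {R : realType} (u : R) (m : nat) : 0 < u ->
  expR (- u) <= (m.+1)`!%:R / u ^+ m.+1.
Proof.
move=> u0; rewrite expRN -[leRHS]invf_div lef_pV2 ?posrE ?expR_gt0//;
    last first.
  by rewrite divr_gt0 ?exprn_gt0// ltr0n fact_gt0.
by apply: le_trans (expR_ge1Dxn m (ltW u0)); rewrite lerDr.
Qed.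

(** The first exponential is bounded with power [2], giving [4 / (k^4 n)], and [ln n <= n]. The
    second needs power [4], since [y^4 = eps^2 n ln n] cancels the factor [n]; here
    [96 = 4 * 4!]. *)
Lemma tail_bound_le_div_ln {R : realType} (n : nat) (eps k y : R) :
  (1 < n)%N -> 0 < eps -> 0 < k -> 0 < y ->
  y ^+ 2 = eps * Num.sqrt (n%:R * ln n%:R) ->
  n%:R * (2 * (expR (- (k ^+ 2 * n%:R)) + 2 * expR (4 - k * y))) <=
  (4 / k ^+ 4 + 96 * expR 4 / (k ^+ 4 * eps ^+ 2)) * (ln n%:R)^-1.
Proof.
move=> n1 eps0 k0 y0 yE.
have n0 : 0 < n%:R :> R by rewrite ltr0n ltnW.
set N : R := n%:R in n0 *.
have L0 : 0 < ln N by rewrite ln_gt0// /N ltr1n.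
set L := ln N in L0 yE *.
have y4 : y ^+ 4 = eps ^+ 2 * (N * L).
  by rewrite -[4%N]/(2 * 2)%N exprM yE exprMn sqr_sqrtr// mulr_ge0// ltW.
have e1 : N * (2 * expR (- (k ^+ 2 * N))) <= 4 / k ^+ 4 * L^-1.
  have := @expRN_le_pow R (k ^+ 2 * N) 1 (mulr_gt0 (exprn_gt0 2 k0) n0).
  move=> /(ler_wpM2l (ler0n _ 2)) /(ler_wpM2l (ltW n0)) /le_trans; apply.
  have -> : N * (2 * (2`!%:R / (k ^+ 2 * N) ^+ 2)) = 4 / k ^+ 4 * N^-1.
    by rewrite (_ : 2`! = 2%N)//; field; rewrite !gt_eqF.
  rewrite ler_pM2l; last by rewrite divr_gt0// exprn_gt0.
  by rewrite lef_pV2 ?posrE// ltW// ln_sublinear.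
have e2 : N * (4 * expR (4 - k * y)) <=
    96 * expR 4 / (k ^+ 4 * eps ^+ 2) * L^-1.
  have := @expRN_le_pow R (k * y) 3 (mulr_gt0 k0 y0).
  move=> /(ler_wpM2l (expR_ge0 4)) /(ler_wpM2l (ler0n _ 4)).
  move=> /(ler_wpM2l (ltW n0)); rewrite -expRD => /le_trans; apply.
  rewrite exprMn y4 (_ : 4`! = 24%N)// le_eqVlt; apply/orP; left; apply/eqP.
  by field; rewrite !gt_eqF.
rewrite [leRHS]mulrDl; apply: le_trans (lerD e1 e2).
by rewrite -mulrDr ler_pM2l//; lra.
Qed.

Lemma cvg_ln_natr {R : realType} : ln (n%:R : R) @[n --> \oo] --> +oo.
Proof.
apply/cvgryPge => A; near=> n.
have An : expR A <= n%:R by near: n; exact: nbhs_infty_ger.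
by rewrite -(expRK A) ler_ln ?posrE ?expR_gt0// (lt_le_trans (expR_gt0 A)).
Unshelve. all: by end_near. Qed.

(** * The limit, by squeezing between [0] and a multiple of [1 / ln n] *)

Theorem lemma2p2 (R : realType) (d : measure_display) (T : measurableType d)
    (P : probability T R) (X0 : {RV P >-> R}) (X : nat -> nat -> {RV P >-> R})
    (hiid : iid_double_array X0 X)
    (hmean : ('E_P[X0] = 0)%E)
    (hvar : ('E_P[(X0 : T -> R) ^+ 2] = 1)%E)
    (eps : R) (heps : 0 < eps) :
  (n%:R%:E *
    P [set w | (n%:R * Num.sqrt (n%:R / ln n%:R) *
                (`|sample_mean X n 1 w * sample_mean X n 2 w| /
                 (Num.sqrt (\sum_(1 <= k < n.+1) X k 1%N w ^+ 2) *
                  Num.sqrt (\sum_(1 <= k < n.+1) X k 2%N w ^+ 2))) > eps)%R]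
    @[n --> \oo] --> 0)%E.
Proof.
have [indep idX] := hiid.
have [k [k0 k1 hk]] := mgf_oppr_sqr hvar.
pose K := 4 / k ^+ 4 + 96 * expR 4 / (k ^+ 4 * eps ^+ 2).
apply: (@squeeze_cvge _ _ _ _ (cst 0%E) _ (fun n => (K * (ln n%:R)^-1)%:E));
    last 2 first.
- exact: cvg_cst.
- apply: cvg_EFin; first exact: nearW.
  rewrite -[X in _ --> X](mulr0 K); apply: cvgM; first exact: cvg_cst.
  apply/gtr0_cvgV0; last exact: cvg_ln_natr.
  by near=> n; rewrite ln_gt0// ltr1n; near: n; exact: nbhs_infty_gt.
near=> n.
have n1 : (1 < n)%N by near: n; exact: nbhs_infty_gt.
apply/andP; split; first by rewrite mule_ge0// lee_fin.
have L0 : 0 < ln (n%:R : R) by rewrite ln_gt0// ltr1n.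
pose y := Num.sqrt (eps * Num.sqrt (n%:R * ln (n%:R : R))).
have ysq_gt0 : 0 < eps * Num.sqrt (n%:R * ln (n%:R : R)).
  by rewrite mulr_gt0// sqrtr_gt0 mulr_gt0// ltr0n ltnW.
have y0 : 0 < y by rewrite sqrtr_gt0.
have yE : y ^+ 2 = eps * Num.sqrt (n%:R * ln (n%:R : R)).
  by rewrite sqr_sqrtr// ltW.
pose S i w := \sum_(1 <= k < n.+1) X k i w.
pose V i w := Num.sqrt (\sum_(1 <= k < n.+1) X k i w ^+ 2).
have mS i : measurable_fun setT (S i).
  by apply: measurable_sum => j; exact: measurable_funPT.
have mV i : measurable_fun setT (V i).
  apply: (measurableT_comp (continuous_measurable_fun (@sqrt_continuous R))).
  apply: measurable_sum => j; apply: measurable_funX; exact: measurable_funPT.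
pose E i := [set w | y * V i w < `|S i w|].
have mE i : measurable (E i).
  rewrite -[X in measurable X]setTI; apply: measurable_fun_ltr => //.
    exact: measurable_funM.
  exact: measurableT_comp.
have PE i : (0 < i)%N -> (P (E i) <=
    (expR (- (k ^+ 2 * n%:R)) + 2 * expR (4 - k * y))%:E)%E.
  (* The first [n] entries of column [i], listed as index pairs of the independent family. *)
  move=> i0; pose s := [seq (j, i) | j <- index_iota 1 n.+1].
  have ss : size s = n by rewrite size_map size_iota subn1.
  have us : uniq s by rewrite map_inj_uniq ?iota_uniq// => a b [].
  have sD ki : ki \in s -> (0 < ki.1)%N /\ (0 < ki.2)%N.
    by move=> /mapP[j + ->]; rewrite mem_index_iota => /andP[].
  have s0 : (0 < size s)%N by rewrite ss ltnW.
  have := @self_normalized_tail _ _ _ P _ _ (fun ki => X ki.1 ki.2) X0 s k y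
    indep (fun ki h => idX _ _ h.1 h.2) hmean hvar k0 k1 hk us sD s0.
  rewrite ss /E /S /V; under eq_set do rewrite !big_map.
  by [].
set F := [set w | _].
have mF : measurable F.
  rewrite -[X in measurable X]setTI; apply: measurable_fun_ltr => //.
  apply: measurable_funM => //; apply: measurable_funM.
    apply: measurableT_comp => //.
    by apply: measurable_funM; apply: measurable_funM => //; exact: (mS _).
  (* On nonnegative reals, [0] included, the inverse is the power [-1], which is measurable. *)
  under eq_fun do rewrite -powR_inv1 ?mulr_ge0 ?sqrtr_ge0//.
  apply: (measurableT_comp (measurable_powR (-1))).
  by apply: measurable_funM; exact: (mV _).
apply: le_trans (_ : (n%:R * (2 * (expR (- (k ^+ 2 * n%:R)) +
  2 * expR (4 - k * y))))%:E <= _)%E; last first.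
  by rewrite lee_fin; exact: tail_bound_le_div_ln.
rewrite EFinM lee_wpmul2l ?lee_fin//.
(* Outside both events the statistic is at most [eps]; the two columns account for the factor
   [2]. *)
apply: (@le_trans _ _ (P (E 1%N `|` E 2%N))).
  apply: le_measure; rewrite ?inE//; first exact: measurableU.
  move=> w; apply: contraPP => /not_orP[/negP + /negP].
  rewrite /E /= -!leNgt => h1 h2; apply/negP; rewrite -leNgt.
  apply: (product_statistic_le (ltnW n1) L0 heps yE (ltW y0) _ _ h1 h2);
    exact: sqrtr_ge0.
apply: le_trans (measureU2 _ (mE _) (mE _)) _.
by rewrite mulr_natl mulr2n EFinD leeD// PE.
Unshelve. all: by end_near. Qed.
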